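(* Let $A$ be a Banach algebra, let $B$ be a right Banach $A$-module with module action $\pi_r:B\times A\to B$, and suppose that $A^{**}$, with the first Arens product, has a right unit $e''$. Then $B=BA$ if and only if $e''$ is a right unit $A^{**}$-module for $B^{**}$, that is, $\pi_r^{***}(b'',e'')=b''$ for all $b''\in B^{**}$.
   Context: For normed spaces $X,Y,Z$ and a bounded bilinear map $m:X\times Y\to Z$, define $m^*:Z^*\times X\to Y^*$ by $\langle m^*(z',x),y\rangle=\langle z',m(x,y)\rangle$; $m^{**}:Y^{**}\times Z^*\to X^*$ by $\langle m^{**}(y'',z'),x\rangle=\langle y'',m^*(z',x)\rangle$; $m^{***}:X^{**}\times Y^{**}\to Z^{**}$ by $\langle m^{***}(x'',y''),z'\rangle=\langle x'',m^{**}(y'',z')\rangle$. Thus $\pi_r^{***}:B^{**}\times A^{**}\to B^{**}$. If $\pi:A\times A\to A$ is the multiplication of $A$, the first Arens product on $A^{**}$ is $a''b''=\pi^{***}(a'',b'')$. A right unit of $A^{**}$ is an element $e''\in A^{**}$ with $a''e''=a''$ for all $a''\in A^{**}$. $BA$ denotes the set $\{ba: b\in B,\ a\in A\}$ of products, where $ba=\pi_r(b,a)$. *)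

(* Defs.v *)
From HB Require Import structures.
From mathcomp Require Import all_boot all_order all_algebra.
From mathcomp Require Import complex.
From mathcomp Require Import boolp classical_sets functions reals.
From mathcomp Require Import topology normedtype.

Set Implicit Arguments.
Unset Strict Implicit.
Unset Printing Implicit Defensive.

Import Order.TTheory GRing.Theory Num.Theory.
Import numFieldNormedType.Exports.

Local Open Scope classical_set_scope.
Local Open Scope ring_scope.

(* Over complex scalars, norms take their values in the (partially ordered)
   field R[i] itself; they are real because they are nonnegative. *)
Variant real_or_complex : numFieldType -> Prop :=
| RealScalars (R : realType) : real_or_complex R
| ComplexScalars (R : realType) : real_or_complex R[i].

Record scalarField := ScalarField {
  scalar_numField :> numFieldType;
  scalarP : real_or_complex scalar_numField
}.

Lemma scalar_has_supremum (K : scalarField) (S : set K) :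
  S !=set0 -> (forall x, S x -> 0 <= x) -> (exists M, ubound S M) ->
  supremums S !=set0.
Proof.
case: K S => K [] R S /= S0 Sge0 [M SM].
  exists (sup S); split; first by apply: sup_upper_bound; split => //; exists M.
  by move=> y Sy; apply: ge_sup.
pose T := [set r : R | S r%:C%C].
have ST x : S x -> exists2 r, T r & x = r%:C%C.
  move=> Sx.
  have /complex_realP[k xk] : x \is Num.real by rewrite ger0_real// Sge0.
  by exists k => //; rewrite /T /= -xk.
have [x Sx] := S0.
have M0 : 0 <= M by exact: le_trans (Sge0 _ Sx) (SM _ Sx).
have /complex_realP[m Mm] : M \is Num.real by rewrite ger0_real.
have Tsup : has_sup T.
  split; first by have [r Tr _] := ST _ Sx; exists r.
  by exists m => r /SM; rewrite Mm lecR.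
exists (sup T)%:C%C; split.
  by move=> y /ST[r Tr ->]; rewrite lecR; exact: sup_upper_bound.
move=> y Sy.
have y0 : 0 <= y by exact: le_trans (Sge0 _ Sx) (Sy _ Sx).
have /complex_realP[k yk] : y \is Num.real by rewrite ger0_real.
rewrite yk lecR; apply: ge_sup; first exact: Tsup.1.
by move=> r /Sy; rewrite yk lecR.
Qed.

Section Dual.
Variables (K : scalarField) (X : normedModType K).

Definition bounded_functional (f : X -> K^o) : Prop :=
  linear f /\ exists M : K, forall x, `|f x| <= M * `|x|.

Definition functionals : {pred X -> K^o} := fun f => `[< bounded_functional f >].

Record dual := Dual { dual_fun :> X -> K^o; dualP : dual_fun \in functionals }.

HB.instance Definition _ := [isSub for dual_fun].
HB.instance Definition _ := [Choice of dual by <:].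

Fact functionals_submod : submod_closed functionals.
Proof.
split.
  apply/asboolP; split; first by move=> a x y; rewrite /= scaler0 addr0.
  by exists 0 => x; rewrite normr0 mul0r.
move=> a f g /asboolP[fl [M fM]] /asboolP[gl [N gN]].
have E z : (a *: f + g) z = a *: f z + g z by [].
apply/asboolP; split.
  move=> b x y; rewrite !E fl gl !scalerDr !scalerA [b * a]mulrC -!addrA.
  by congr (_ + _); rewrite addrCA.
exists (`|a| * M + N) => x; rewrite E mulrDl -mulrA.
rewrite (le_trans (ler_normD _ _))// lerD// normrZ ler_wpM2l//.
Qed.

HB.instance Definition _ :=
  GRing.isSubmodClosed.Build K (X -> K^o) functionals functionals_submod.
HB.instance Definition _ := [SubChoice_isSubLmodule of dual by <:].


Lemma dual_linear (f : dual) : linear f.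
Proof. by have /asboolP[] := dualP f. Qed.

HB.instance Definition _ (f : dual) :=
  GRing.isLinear.Build K X K^o _ f (@dual_linear f).

Lemma dual_bounded (f : dual) :
  exists2 M : K, 0 <= M & forall x, `|f x| <= M * `|x|.
Proof.
have /asboolP[_ [M fM]] := dualP f.
have [[x x0]|X0] := pselect (exists x : X, x != 0).
  exists M => //; have := le_trans (normr_ge0 _) (fM x).
  by rewrite pmulr_lge0// normr_gt0.
exists 0 => // x; have [->|x0] := eqVneq x 0; first by rewrite linear0 !normr0 mulr0.
by case: X0; exists x.
Qed.

(* In R[i], supremum refers to the partial order of R[i]; it exists because the
   set is nonempty, bounded, and made of nonnegative, hence real, elements:
   see dual_norm_supremums. *)
Definition dual_norm (f : dual) : K :=
  supremum 0 [set `|f x| | x in [set x : X | `|x| <= 1]].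

Lemma dual_norm_supremums (f : dual) :
  supremums [set `|f x| | x in [set x : X | `|x| <= 1]] (dual_norm f).
Proof.
have S0 : [set `|f x| | x in [set x : X | `|x| <= 1]] !=set0.
  by exists `|f 0|, 0; rewrite //= normr0.
rewrite /dual_norm /supremum; case: ifPn => [/eqP SE|_].
  by move: S0; rewrite SE => -[].
have [||c Sc] := scalar_has_supremum S0; last exact: xgetI Sc.
  by move=> _ [x _ <-].
have [M M0 fM] := dual_bounded f; exists M => _ [x /= x1 <-].
by rewrite (le_trans (fM x))// ler_piMr.
Qed.

Lemma dual_norm_ge0 (f : dual) : 0 <= dual_norm f.
Proof.
have [ub _] := dual_norm_supremums f.
by apply: (le_trans (normr_ge0 (f 0))); apply: ub; exists 0; rewrite //= normr0.
Qed.

Lemma ler_dual_norm (f : dual) x : `|f x| <= dual_norm f * `|x|.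
Proof.
have [->|x0] := eqVneq x 0; first by rewrite linear0 !normr0 mulr0.
have nx0 : 0 < `|x| by rewrite normr_gt0.
have [ub _] := dual_norm_supremums f.
have : `|f (`|x|^-1 *: x)| <= dual_norm f.
  apply: ub; exists (`|x|^-1 *: x) => //=.
  by rewrite normrZ normfV normr_id mulVf// gt_eqF.
by rewrite linearZ normrZ normfV normr_id mulrC ler_pdivrMr.
Qed.

Lemma dual_norm_le (f : dual) (M : K) : 0 <= M ->
  (forall x, `|f x| <= M * `|x|) -> dual_norm f <= M.
Proof.
move=> M0 fM; have [_ lub] := dual_norm_supremums f.
by apply: lub => _ [x /= x1 <-]; rewrite (le_trans (fM x))// ler_piMr.
Qed.

Fact dual_normD (f g : dual) : dual_norm (f + g) <= dual_norm f + dual_norm g.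
Proof.
apply: dual_norm_le; first by rewrite addr_ge0// dual_norm_ge0.
by move=> x; rewrite mulrDl (le_trans (ler_normD _ _))// lerD// ler_dual_norm.
Qed.

Fact dual_normZ (a : K) (f : dual) : dual_norm (a *: f) = `|a| * dual_norm f.
Proof.
have le (b : K) (g : dual) : dual_norm (b *: g) <= `|b| * dual_norm g.
  apply: dual_norm_le => [|x]; first by rewrite mulr_ge0// dual_norm_ge0.
  by rewrite normrZ -mulrA ler_wpM2l// ler_dual_norm.
apply/eqP; rewrite eq_le le/=.
have [->|a0] := eqVneq a 0; first by rewrite normr0 mul0r dual_norm_ge0.
rewrite mulrC -ler_pdivlMr ?normr_gt0// mulrC -normfV.
by have := le a^-1 (a *: f); rewrite scalerA mulVf// scale1r.
Qed.

Fact dual_norm_eq0 (f : dual) : dual_norm f = 0 -> f = 0.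
Proof.
move=> f0; apply/val_inj/funext => x; apply/eqP.
by have := ler_dual_norm f x; rewrite f0 mul0r normr_le0.
Qed.

HB.instance Definition _ :=
  Lmodule_isNormed.Build K dual dual_normD dual_normZ dual_norm_eq0.

Lemma dual_normE (f : dual) : `|f| = dual_norm f. Proof. by []. Qed.

Lemma ler_norm_dual (f : dual) x : `|f x| <= `|f| * `|x|.
Proof. exact: ler_dual_norm. Qed.

End Dual.

Section BoundedBilinear.
Variables (K : scalarField) (X Y Z : normedModType K).

Record bounded_bilinear := BoundedBilinear {
  bilinear_map :> {bilinear X -> Y -> Z};
  bilinear_bounded :
    exists M : K, forall x y, `|bilinear_map x y| <= M * `|x| * `|y|
}.

Variable m : bounded_bilinear.

Lemma bilinear_boundedW :
  exists2 M : K, 0 <= M & forall x y, `|m x y| <= M * `|x| * `|y|.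
Proof.
have [M mM] := bilinear_bounded m.
have [[x [y [x0 y0]]]|XY0] :=
    pselect (exists (x : X) (y : Y), x != 0 /\ y != 0).
  exists M => //; have := le_trans (normr_ge0 _) (mM x y).
  by rewrite -mulrA pmulr_lge0// mulr_gt0// normr_gt0.
exists 0 => // x y; have [->|x0] := eqVneq x 0.
  by rewrite linear0l !normr0 mulr0 mul0r.
have [->|y0] := eqVneq y 0; first by rewrite linear0r !normr0 !mulr0.
by case: XY0; exists x, y.
Qed.

Fact adjoint_fun_subproof (z' : dual Z) (x : X) :
  (fun y => z' (m x y) : K^o) \in @functionals K Y.
Proof.
apply/asboolP; split=> [a y1 y2|]; first by rewrite /= linearPr linearP.
have [M M0 mM] := bilinear_boundedW.
exists (`|z'| * (M * `|x|)) => y; rewrite -mulrA.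
by rewrite (le_trans (ler_norm_dual _ _))// ler_wpM2l.
Qed.

Definition adjoint_fun (z' : dual Z) (x : X) : dual Y :=
  Dual (adjoint_fun_subproof z' x).

Fact adjoint_fun_bilinear : bilinear_for *:%R *:%R adjoint_fun.
Proof.
split=> [x a f g|z' a x1 x2]; apply/val_inj/funext => y //=.
by rewrite linearPl linearP.
Qed.

HB.instance Definition _ := bilinear_isBilinear.Build K (dual Z) X (dual Y)
  *:%R *:%R adjoint_fun adjoint_fun_bilinear.

Fact adjoint_fun_bounded :
  exists M : K, forall z' x, `|adjoint_fun z' x| <= M * `|z'| * `|x|.
Proof.
have [M M0 mM] := bilinear_boundedW; exists M => z' x.
apply: dual_norm_le => [|y]; first by rewrite !mulr_ge0.
rewrite (le_trans (ler_norm_dual z' _))//.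
by rewrite [M * `|z'|]mulrC -!mulrA ler_wpM2l// mulrA.
Qed.

End BoundedBilinear.

(* m^*, see adjointE *)
Definition adjoint (K : scalarField) (X Y Z : normedModType K)
    (m : bounded_bilinear X Y Z) : bounded_bilinear (dual Z) X (dual Y) :=
  BoundedBilinear (adjoint_fun_bounded m).

Lemma adjointE (K : scalarField) (X Y Z : normedModType K)
    (m : bounded_bilinear X Y Z) (z' : dual Z) (x : X) (y : Y) :
  adjoint m z' x y = z' (m x y).
Proof. by []. Qed.

(* m^*** *)
Definition triple_adjoint (K : scalarField) (X Y Z : normedModType K)
    (m : bounded_bilinear X Y Z) :
    bounded_bilinear (dual (dual X)) (dual (dual Y)) (dual (dual Z)) :=
  adjoint (adjoint (adjoint m)).

(* Neither a unit nor, for modules, contractivity of the action is required. *)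
Record banachAlgebra (K : scalarField) := BanachAlgebra {
  banach_space :> completeNormedModType K;
  banach_mul : bounded_bilinear banach_space banach_space banach_space;
  banach_mulA : associative banach_mul;
  banach_mul_le : forall a b, `|banach_mul a b| <= `|a| * `|b|
}.

Record rightBanachModule (K : scalarField) (A : banachAlgebra K) :=
  RightBanachModule {
    module_space :> completeNormedModType K;
    module_action : bounded_bilinear module_space A module_space;
    module_actionA : forall b a a',
      module_action (module_action b a) a' =
      module_action b (banach_mul A a a')
  }.

(* First Arens product *)
Definition arens_mul (K : scalarField) (A : banachAlgebra K) :
    bounded_bilinear (dual (dual A)) (dual (dual A)) (dual (dual A)) :=
  triple_adjoint (banach_mul A).

(* Main.v *)
Require Import Defs.
From mathcomp Require Import all_boot all_order all_algebra.
From mathcomp Require Import complex.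
From mathcomp Require Import boolp classical_sets functions reals.
From mathcomp Require Import topology normedtype.

Set Implicit Arguments.
Unset Strict Implicit.
Unset Printing Implicit Defensive.

Import Order.TTheory GRing.Theory Num.Theory.
Import numFieldNormedType.Exports.

Local Open Scope classical_set_scope.
Local Open Scope ring_scope.

(** If B = BA, then for f in B^* and b = b1 a the functional a' |-> f (b a') is
    the adjoint of the multiplication of A taken at (a' |-> f (b1 a'), a).  On
    such functionals e'' is evaluation at a, because e'' is a right unit; hence
    e'' sends a' |-> f (b a') to f b for all f and b, which is the claim.

    Conversely, e'' then behaves like a weak-star limit of elements u of A with
    x u -> x weakly for all x in A and b u -> b weakly for all b in B.
    [weak_star_to_norm_approx] turns this into norm approximation by a bounded
    set: for x in A, b in B and d > 0 there is u with |u| <= |e''| + 1, for which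
    x u and b u are within d of x and b.  It does in one step what is usually
    done with the theorems of Goldstine and Mazur, by applying the Hahn-Banach
    theorem to the seminorm
      p z = inf_u (|u| + W (|z.1 - x u| + |z.2 - b u|)).
    A functional F dominated by p, with p (x, b) <= |F (x, b)|, restricts to a
    functional of norm at most 1 on A (along u |-> (x u, b u)), and applying e''
    to that restriction returns F (x, b), so that p (x, b) <= |e''|, however
    large W is.

    With these approximate units, Cohen's method ([cohen_factorization]) writes
    each b as a product y a, where y and a are limits of a recursive construction
    in the unitization of A.

    The scalars K are either real or complex, and the order of K is partial in
    the complex case.  Infima and sublinear functionals are therefore K-valued
    with real values, so that both cases are treated alike up to the end of the
    proof of [hahn_banach]. *)

(** * Infima of sets of real scalars *)

Section Infima.
Variable K : scalarField.

Lemma real_infimums (S : set K) (m : K) :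
  S !=set0 -> (forall x, S x -> x \is Num.real) -> m \is Num.real ->
  lbound S m -> infimums S (infimum 0 S).
Proof.
move=> S0 Sreal mreal mS.
rewrite /infimum; case: ifPn => [/eqP SE|_]; first by move: S0; rewrite SE => -[].
suff [i Si] : infimums S !=set0 by exact: xgetI Si.
have [y0 Sy0] := S0.
(* The infimum is m plus the supremum of the x >= 0 for which m + x is still a
   lower bound. *)
pose T := [set x : K | 0 <= x /\ lbound S (m + x)].
have [|||c [cub club]] := @scalar_has_supremum K T.
- by exists 0; split=> //; rewrite addr0.
- by move=> x [].
- by exists (y0 - m) => x [_ /(_ _ Sy0)]; rewrite lerBrDl.
exists (m + c); split.
  by move=> y Sy; rewrite -lerBrDl; apply: club => x [_ /(_ _ Sy)]; rewrite lerBrDl.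
move=> l lS.
have lreal : l \is Num.real by rewrite -(ger_real (lS _ Sy0)) Sreal.
rewrite -lerBlDl; have [lm|ml] := real_leP lreal mreal.
  rewrite (@le_trans _ _ 0) ?subr_le0//; apply: cub; split=> //.
  by rewrite addr0.
apply: cub; split; first by rewrite subr_ge0 ltW.
by rewrite addrC subrK.
Qed.

Definition pointwise_inf (I : Type) (V : Type) (g : I -> V -> K) (x : V) : K :=
  infimum 0 [set g i x | i in [set: I]].

Section PointwiseInf.
Variables (I V : Type) (i0 : I) (g : I -> V -> K) (x : V) (m : K).
Hypothesis greal : forall i, g i x \is Num.real.
Hypothesis mreal : m \is Num.real.
Hypothesis mg : forall i, m <= g i x.

Let infg : infimums [set g i x | i in [set: I]] (pointwise_inf g x).
Proof.
apply: real_infimums mreal _; first by exists (g i0 x), i0.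
  by move=> _ [i _ <-].
by move=> _ [i _ <-].
Qed.

Lemma pointwise_inf_le i : pointwise_inf g x <= g i x.
Proof. by apply: infg.1; exists i. Qed.

Lemma le_pointwise_inf l : (forall i, l <= g i x) -> l <= pointwise_inf g x.
Proof. by move=> lg; apply: infg.2 => _ [i _ <-]. Qed.

Lemma pointwise_inf_real : pointwise_inf g x \is Num.real.
Proof. by rewrite -(ger_real (pointwise_inf_le i0)). Qed.

End PointwiseInf.
End Infima.

(** * The Hahn-Banach theorem *)

Section HahnBanach.
Variables (K : scalarField) (V : lmodType K).
Implicit Types (p q : V -> K) (x y : V) (t : K).

Definition sublinear q : Prop :=
  [/\ forall x, q x \is Num.real, forall x y, q (x + y) <= q x + q y
    & forall t x, 0 < t -> q (t *: x) <= t * q x].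

Lemma sublinear0 q : sublinear q -> q 0 = 0.
Proof.
move=> [qr qD qZ]; apply/le_anti/andP; split.
  have := qZ 2^-1 0; rewrite scaler0 invr_gt0 ltr0n => /(_ isT).
  rewrite -(ler_pM2l (ltr0n K 2)) mulrA divff ?pnatr_eq0// mul1r.
  by rewrite mulr_natl mulr2n gerDl.
by have := qD 0 0; rewrite addr0 lerDl.
Qed.

Lemma sublinearZ q t x : sublinear q -> 0 <= t -> q (t *: x) = t * q x.
Proof.
move=> sq; rewrite le_eqVlt => /predU1P[<-|t0].
  by rewrite scale0r mul0r sublinear0.
have [_ _ qZ] := sq; apply/le_anti; rewrite qZ//=.
rewrite -ler_pdivlMl// -{1}[x](scalerK (lt0r_neq0 t0)) qZ// invr_gt0//.
Qed.

Lemma sublinear_geN q x : sublinear q -> - q (- x) <= q x.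
Proof.
by move=> sq; have [_ qD _] := sq; rewrite lerNl -subr_ge0 opprK addrC
  (le_trans _ (qD _ _))// subrr sublinear0.
Qed.

(** The members of the family need not be sublinear: two members may be combined
    into a third one when arguments are added.  Chains of sublinear functionals
    are of this form, and so are infimal convolutions such as
    inf_t (q (x + t y) - t q y). *)
Lemma sublinear_pointwise_inf (I : Type) (i0 : I) (g : I -> V -> K) (m : V -> K) :
  (forall i x, g i x \is Num.real) -> (forall x, m x \is Num.real) ->
  (forall i x, m x <= g i x) ->
  (forall i j x y, exists k, g k (x + y) <= g i x + g j y) ->
  (forall t i x, 0 < t -> exists k, g k (t *: x) <= t * g i x) ->
  sublinear (pointwise_inf g).
Proof.
move=> gr mr mg gD gZ.
have le i x := pointwise_inf_le (g := g) i0 (gr^~ x) (mr x) (mg^~ x) i.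
have ge x l := le_pointwise_inf (g := g) i0 (gr^~ x) (mr x) (mg^~ x) (l := l).
split=> [x|x y|t x t0].
- exact: (pointwise_inf_real (g := g) i0 (gr^~ x) (mr x) (mg^~ x)).
- rewrite -lerBlDr; apply: (ge x) => i; rewrite lerBlDr -lerBlDl; apply: (ge y) => j.
  by rewrite lerBlDl; have [k] := gD i j x y; exact: le_trans.
- rewrite -ler_pdivrMl//; apply: (ge x) => i; rewrite ler_pdivrMl//.
  by have [k] := gZ t i x t0; exact: le_trans.
Qed.

(** The functional r x = inf_(t >= 0) (q (x + t y) - t q y): taking t = 0 gives
    r <= q, and t = 1 gives the bound at - y. *)
Lemma sublinear_shift q y : sublinear q ->
  exists r, [/\ sublinear r, forall x, r x <= q x & r (- y) <= - q y].
Proof.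
move=> sq; have [qr qD qZ] := sq.
(* The family is indexed by all of K, with |t| ranging over the t >= 0. *)
pose g t x := q (x + `|t| *: y) - `|t| * q y.
have gr t x : g t x \is Num.real by rewrite rpredB// rpredM// normr_real.
have mr x : - q (- x) \is Num.real by rewrite rpredN.
have mg t x : - q (- x) <= g t x.
  rewrite /g lerBrDr addrC lerBlDr -sublinearZ//.
  by apply: le_trans (qD _ _); rewrite addrAC subrr add0r.
have le t x := pointwise_inf_le (g := g) 0 (gr^~ x) (mr x) (mg^~ x) t.
exists (pointwise_inf g); split.
- apply: (sublinear_pointwise_inf 0 gr mr mg) => [s t x x'|t s x t0].
    exists (`|s| + `|t|); rewrite /g ger0_norm ?addr_ge0//.
    rewrite scalerDl mulrDl opprD [X in _ <= X]addrACA lerD2r addrACA.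
    exact: qD.
  exists (t * s); rewrite /g normrM (gtr0_norm t0) -scalerA -scalerDr.
  by rewrite (sublinearZ _ sq (ltW t0)) -mulrA -mulrBr.
- by move=> x; rewrite (le_trans (le 0 x))// /g normr0 scale0r addr0 mul0r subr0.
- rewrite (le_trans (le 1 _))// /g normr1 scale1r addNr sublinear0// mul1r.
  by rewrite sub0r.
Qed.

(** Zorn's lemma: the infimum of a chain of sublinear functionals below p is
    sublinear, being bounded below by - p (- x). *)
Lemma minimal_sublinear p : sublinear p ->
  exists f, [/\ sublinear f, forall x, f x <= p x
    & forall q, sublinear q -> (forall x, q x <= f x) -> forall x, f x <= q x].
Proof.
move=> sp; have [pr pD pZ] := sp.
pose T := {q | sublinear q /\ forall x, q x <= p x}.
pose t0 : T := exist _ p (conj sp (fun=> lexx _)).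
pose R : rel T := fun a b => `[< forall x, sval b x <= sval a x >].
have [|||[f [sf fp]] fmin] := @ZL_preorder T t0 R.
- by move=> a; apply/asboolP => x.
- by move=> a b c /asboolP ab /asboolP bc; apply/asboolP => x; exact: le_trans (bc x) _.
- move=> A Atot; have [[a0 Aa0]|A0] := pselect (exists a, A a); last first.
    by exists t0 => s As; case: A0; exists s.
  pose g (i : {a | A a}) x := sval (sval i) x.
  have sg i : sublinear (g i) by case: i => -[a []].
  have gp i x : g i x <= p x by case: i => -[a []].
  have gr i x : g i x \is Num.real by have [] := sg i.
  have mr x : - p (- x) \is Num.real by rewrite rpredN.
  have mg i x : - p (- x) <= g i x.
    by rewrite (le_trans _ (sublinear_geN x (sg i)))// lerN2.
  pose i0 : {a | A a} := exist _ a0 Aa0.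
  have le i x := pointwise_inf_le (g := g) i0 (gr^~ x) (mr x) (mg^~ x) i.
  have sinf : sublinear (pointwise_inf g).
    apply: (sublinear_pointwise_inf i0 gr mr mg) => [i j x y|t i x t0'].
      case: (Atot _ _ (svalP i) (svalP j)) => /asboolP ij.
        by exists j; have [_ gD _] := sg j; rewrite (le_trans (gD _ _))// lerD2r; exact: ij.
      by exists i; have [_ gD _] := sg i; rewrite (le_trans (gD _ _))// lerD2l; exact: ij.
    by exists i; have [_ _ gZ] := sg i; exact: gZ.
  have infp x : pointwise_inf g x <= p x by rewrite (le_trans (le i0 x)).
  pose inf : T := exist _ (pointwise_inf g) (conj sinf infp).
  exists inf => s As.
  by apply/asboolP => x; exact: (le (exist _ s As) x).
exists f; split=> // q sq qf.
have qp x : q x <= p x by rewrite (le_trans (qf x)).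
pose q' : T := exist _ q (conj sq qp).
by have /asboolP := fmin q' (introT (asboolP _) qf); apply.
Qed.

(** A minimal sublinear functional f is linear over the reals: its shift by x is
    not smaller than f, which forces f (- x) = - f x, and an odd sublinear
    functional is additive.  Shifting p by v0 beforehand gives p v0 <= f v0. *)
Lemma real_hahn_banach p v0 : sublinear p ->
  exists f : V -> K, [/\ forall x, f x \is Num.real,
    forall x y, f (x + y) = f x + f y,
    forall t x, t \is Num.real -> f (t *: x) = t * f x,
    forall x, f x <= p x & p v0 <= f v0].
Proof.
move=> sp; have [p0 [sp0 p0p p0v]] := sublinear_shift v0 sp.
have [f [sf fp0 fmin]] := minimal_sublinear sp0.
have [fr fD _] := sf.
have fN x : f (- x) = - f x.
  apply/le_anti/andP; split; last by rewrite lerNl sublinear_geN.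
  have [q [sq qf qN]] := sublinear_shift x sf.
  exact: le_trans (fmin q sq qf _) qN.
exists f; split=> // [x y|t x|x|].
- apply/le_anti; rewrite fD/= -lerBrDr -fN.
  by apply: le_trans (fD _ _); rewrite addrK.
- case/real_ge0P => [t0|t0]; first exact: sublinearZ.
  rewrite -[t]opprK scaleNr fN sublinearZ ?mulNr// oppr_ge0 ltW//.
- by rewrite (le_trans (fp0 x)).
- by rewrite -lerN2 -fN (le_trans (fp0 _)).
Qed.

End HahnBanach.

(** The classical passage from a real functional f to the complex functional
    F x = f x - i f (i x), whose real part is f.  Rotating x so that F x becomes
    its own absolute value bounds |F x| by p x. *)
Lemma complexify (C : numClosedFieldType) (V : lmodType C) (p f : V -> C) :
  (forall a x, p (a *: x) <= `|a| * p x) ->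
  (forall x, f x \is Num.real) -> (forall x y, f (x + y) = f x + f y) ->
  (forall t x, t \is Num.real -> f (t *: x) = t * f x) ->
  (forall x, f x <= p x) ->
  exists F : V -> C^o, [/\ linear F, forall x, `|F x| <= p x
    & forall x, f x <= `|F x|].
Proof.
move=> pZ fr fD fZ fp.
pose F x : C := f x - 'i * f ('i *: x).
have ReF x : 'Re (F x) = f x by rewrite /F -mulrN Re_rect ?rpredN.
have FD x y : F (x + y) = F x + F y.
  by rewrite /F scalerDr !fD mulrDr opprD addrACA.
have FZr t x : t \is Num.real -> F (t *: x) = t * F x.
  by move=> tr; rewrite /F scalerA ['i * t]mulrC -scalerA !(fZ t)// mulrBr mulrCA.
have Fi x : F ('i *: x) = 'i * F x.
  rewrite /F scalerA -expr2 sqrCi mulrBr mulrA -expr2 sqrCi (fZ (-1)) ?rpredN ?rpred1//.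
  by rewrite !mulN1r mulrN !opprK addrC.
have FZ a x : F (a *: x) = a * F x.
  rewrite [a]Crect scalerDl FD FZr ?Creal_Re// -scalerA Fi FZr ?Creal_Im//.
  by rewrite mulrDl mulrA.
exists F; split=> [a x y|x|x].
- by rewrite FD FZ.
- have [Fx0|Fx0] := eqVneq (F x) 0.
    by have := fp x; rewrite -ReF Fx0 raddf0 normr0.
  set a := `|F x| / F x.
  have a1 : `|a| = 1 by rewrite normf_div normr_id divff// normr_eq0.
  have : f (a *: x) = `|F x|.
    by rewrite -ReF FZ /a mulfVK//; apply/Creal_ReP; rewrite normr_real.
  by move<-; rewrite (le_trans (fp _))// (le_trans (pZ _ _))// a1 mul1r.
- rewrite -ReF (le_trans _ (leif_normC_Re_Creal (F x)))//.
  by rewrite real_ler_norm// Creal_Re.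
Qed.

Lemma hahn_banach (K : scalarField) (V : lmodType K) (p : V -> K) (v0 : V) :
  (forall x, p x \is Num.real) -> (forall x y, p (x + y) <= p x + p y) ->
  (forall a x, p (a *: x) <= `|a| * p x) ->
  exists F : V -> K^o, [/\ linear F, forall x, `|F x| <= p x
    & p v0 <= `|F v0|].
Proof.
move=> pr pD pZ.
have [|f [fr fD fZ fp fv0]] := @real_hahn_banach K V p v0.
  by split=> // t x t0; rewrite (le_trans (pZ _ _))// gtr0_norm.
case: K V p v0 f pr pD pZ fr fD fZ fp fv0 => K [] R V p v0 f pr pD pZ fr fD fZ fp fv0.
  exists f; split=> [a x y|x|]; first by rewrite fD fZ// num_real.
    rewrite ler_norml fp andbT lerNl; have := fp (- x).
    rewrite -scaleN1r fZ ?num_real// mulN1r => /le_trans -> //.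
    by rewrite (le_trans (pZ _ _))// normrN normr1 mul1r.
  by rewrite (le_trans fv0)// ler_norm.
have [F [Fl Fp fF]] := @complexify R[i] V p f pZ fr fD fZ fp.
by exists F; split=> //; rewrite (le_trans fv0).
Qed.

(** * Geometric convergence *)

Section Geometric.
Variable K : scalarField.
Implicit Types r e D : K.

(** The infimum i of the powers of r satisfies i <= r i, hence vanishes. *)
Lemma expr_lt_small r e : 0 < r < 1 -> 0 < e -> exists n, r ^+ n < e.
Proof.
move=> /andP[r0 r1] e0; pose S := [set r ^+ n | n in [set: nat]].
have r_ge0 n : 0 <= r ^+ n by rewrite exprn_ge0// ltW.
have [lb glb] : infimums S (infimum 0 S).
  apply: (@real_infimums _ _ 0) => //.
  - by exists (r ^+ 0), 0%N.
  - by move=> _ [n _ <-]; rewrite ger0_real.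
  - by move=> _ [n _ <-].
set i := infimum 0 S in lb glb.
have i0 : 0 <= i by apply: glb => _ [n _ <-].
have ir : i <= r * i.
  rewrite -ler_pdivrMl//; apply: glb => _ [n _ <-].
  by rewrite ler_pdivrMl// -exprS; apply: lb; exists n.+1.
have {}i0 : i = 0.
  apply/eqP; apply: contraTT ir => inz.
  by rewrite lt_geF// gtr_pMl// lt_def inz.
apply: contrapT => /forallNP re.
have : e <= i.
  apply: glb => _ [n _ <-].
  by rewrite real_leNgt ?gtr0_real ?exprn_gt0//; apply/negP.
by rewrite i0 lt_geF.
Qed.

Lemma geometric_eq0 (V : normedModType K) r E (z : V) : 0 < r < 1 -> 0 <= E ->
  (forall n, `|z| <= E * r ^+ n) -> z = 0.
Proof.
move=> r01 E0 zE; apply/eqP; rewrite -normr_eq0; apply/negPn/negP => z0.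
have {}z0 : 0 < `|z| by rewrite lt_def z0 normr_ge0.
have E1 : 0 < E + 1 by rewrite ltr_wpDl.
have [n rn] := expr_lt_small r01 (divr_gt0 z0 E1).
have := zE n; rewrite lt_geF//.
rewrite ltr_pdivlMr// mulrC in rn; apply: le_lt_trans rn.
by rewrite ler_wpM2r ?lerDl// exprn_ge0// ltW//; case/andP: r01.
Qed.

Lemma geometric_cvg (V : completeNormedModType K) (u : nat -> V) r D :
  0 < r < 1 -> 0 <= D -> (forall n, `|u n.+1 - u n| <= D * r ^+ n) ->
  exists l, exists2 E, 0 <= E & forall n, `|l - u n| <= E * r ^+ n.
Proof.
move=> r01 D0 uD; have /andP[r0 r1] := r01.
have rn0 n : 0 < r ^+ n by rewrite exprn_gt0.
have r1' : 0 < 1 - r by rewrite subr_gt0.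
pose E0 := D / (1 - r); pose E := E0 + 1.
have E00 : 0 <= E0 by rewrite divr_ge0// ltW.
have E_gt0 : 0 < E by rewrite ltr_wpDl.
have DE : D = E0 * (1 - r) by rewrite /E0 divfK// gt_eqF.
have tail n m : `|u (n + m)%N - u n| <= E0 * (r ^+ n - r ^+ (n + m)).
  elim: m => [|m IH]; first by rewrite addn0 !subrr normr0 mulr0.
  rewrite -[u (n + m.+1)%N](subrK (u (n + m)%N)) -addrA (le_trans (ler_normD _ _))//.
  rewrite addnS (le_trans (lerD (uD _) IH))// DE exprS -mulrA -mulrDr.
  by rewrite mulrBl mul1r addrCA addrAC subrr add0r.
(* E exceeds E0 so that this bound is strict even when D = 0. *)
have near n m : (n <= m)%N -> `|u m - u n| < E * r ^+ n.
  move=> /subnKC <-; apply: le_lt_trans (tail _ _) _.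
  apply: (@le_lt_trans _ _ (E0 * r ^+ n)); last by rewrite ltr_pM2r// /E ltrDl.
  by rewrite ler_wpM2l// gerBl ltW.
have cu : cauchy (u @ \oo).
  apply: cauchy_exP => e e0.
  have [n rn] := expr_lt_small r01 (divr_gt0 e0 E_gt0).
  exists (u n); exists n => // m /= nm; rewrite -ball_normE /= distrC.
  by rewrite (lt_trans (near _ _ nm))// mulrC -ltr_pdivlMr.
have /cvgrPdist_lt ul : cvg (u @ \oo) by exact: cauchy_cvg.
exists (lim (u @ \oo)), (E *+ 2) => [|n]; first by rewrite mulrn_wge0// ltW.
have [N _ uN] := ul (E * r ^+ n) (mulr_gt0 E_gt0 (rn0 n)).
(* Compare the limit with a term beyond N, at the cost of a second E * r ^+ n. *)
have {}uN := uN _ (leq_maxl N n); have un := near _ _ (leq_maxr N n).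
rewrite -(subrK (u (maxn N n)) (lim _)) -addrA (le_trans (ler_normD _ _))//.
by rewrite mulrnAl mulr2n lerD// ltW.
Qed.

(** The fixed-point iteration for y = x + L y. *)
Lemma small_perturbation_surj (V : completeNormedModType K) (L : V -> V) :
  (forall y z, L (y - z) = L y - L z) -> (forall y, `|L y| <= 2^-1 * `|y|) ->
  forall x, exists2 y, y - L y = x & `|y| <= 2 * `|x|.
Proof.
move=> LB Lle x; pose u n := iter n (fun y => x + L y) 0.
have half01 : 0 < (2^-1 : K) < 1.
  by rewrite invr_gt0 ltr0n /= invf_lt1 ?ltr0n// ltr1n.
have [half0 half1] : 0 <= (2^-1 : K) /\ (2^-1 : K) <= 1.
  by case/andP: half01 => /ltW ? /ltW.
have uD n : `|u n.+1 - u n| <= `|x| * 2^-1 ^+ n.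
  elim: n => [|n IH].
    have L0 : L 0 = 0 by have := LB 0 0; rewrite !subrr.
    by rewrite /= L0 addr0 subr0 expr0 mulr1.
  have -> : u n.+2 - u n.+1 = L (u n.+1 - u n).
    by rewrite LB /= [in LHS]opprD addrACA subrr add0r.
  by rewrite (le_trans (Lle _))// exprS mulrCA ler_wpM2l// invr_ge0 ler0n.
have [y [E E0 yu]] := geometric_cvg half01 (normr_ge0 x) uD.
have yx : y - L y = x.
  apply/eqP; rewrite -subr_eq0; apply/eqP.
  apply: (geometric_eq0 half01 (mulrn_wge0 2 E0)) => n.
  have -> : y - L y - x = (y - u n.+1) - L (y - u n).
    by rewrite LB /= opprB opprD !addrA subrK addrAC.
  rewrite (le_trans (ler_normB _ _))// mulrnAl mulr2n lerD//.
    rewrite (le_trans (yu _))// ler_wpM2l// exprS ler_piMl ?exprn_ge0//.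
  rewrite (le_trans (Lle _))// (le_trans _ (yu n))// ler_piMl//.
exists y => //.
have : `|y| <= `|x| + 2^-1 * `|y|.
  by rewrite -{1}[y](subrK (L y)) yx (le_trans (ler_normD _ _))// lerD2l.
rewrite -lerBlDr -{1}[`|y|]mul1r -mulrBl.
have -> : 1 - 2^-1 = 2^-1 :> K by rewrite {1}(splitr 1) mul1r addrK.
by rewrite -ler_pdivlMl ?invr_gt0// invrK.
Qed.

End Geometric.

(** * Cohen's factorization *)

Section Cohen.
Variables (K : scalarField) (A : banachAlgebra K) (B : rightBanachModule A).
Local Notation "x ** a" := (banach_mul A x a) (at level 40, left associativity).
Local Notation "b <| a" := (module_action B b a) (at level 40, left associativity).

(** The right action on B of the element s + a of the unitization of A. *)
Definition unitization_action (s : K) (a : A) (y : B) : B := s *: y + y <| a.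

Lemma unitization_actionD s a y z :
  unitization_action s a (y + z) =
  unitization_action s a y + unitization_action s a z.
Proof. by rewrite /unitization_action scalerDr linearDl addrACA. Qed.

Section Step.
Variables (M C : K) (b : B).
Hypothesis M0 : 0 <= M.
Hypothesis actM : forall y (a : A), `|y <| a| <= M * `|y| * `|a|.
Hypothesis C0 : 0 <= C.
Hypothesis approx : forall (a : A) (d : K), 0 < d ->
  exists u : A, [/\ `|u| <= C, `|a ** u - a| <= d & `|b <| u - b| <= d].

(* With this c, right multiplication by (1 - c) + c e differs from the identity by
   an operator of norm at most 1 / 2, whenever |e| <= C. *)
Let c : K := 2^-1 / (1 + M * C).
Let r : K := 1 - c.

Let MC0 : 0 < 1 + M * C.
Proof. by rewrite ltr_wpDr ?mulr_ge0. Qed.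
Let c0 : 0 < c.
Proof. by rewrite divr_gt0// invr_gt0 ltr0n. Qed.
Let c1 : c < 1.
Proof.
rewrite /c ltr_pdivrMr// mul1r (@lt_le_trans _ _ 1)//.
  by rewrite invf_lt1 ?ltr0n// ltr1n.
by rewrite lerDl mulr_ge0.
Qed.
Let r01 : 0 < r < 1.
Proof. by rewrite subr_gt0 c1 /= gtrBl. Qed.
Let r0 : 0 < r. Proof. by case/andP: r01. Qed.
Let rn0 n : 0 <= r ^+ n. Proof. by rewrite exprn_ge0// ltW. Qed.

(** The pair s = (a, y) satisfies y (r^n + a) = b, where r^n + a is a product of n
    factors (1 - c) + c e.  Each factor acts invertibly with an inverse of norm at
    most 2; of this only the existence of small preimages is recorded, so that
    no inverse has to be formed in the unitization. *)
Definition factor_invariant n (s : A * B) : Prop :=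
  unitization_action (r ^+ n) s.1 s.2 = b /\
  forall x, exists2 y, unitization_action (r ^+ n) s.1 y = x
    & `|y| <= 2 ^+ n * `|x|.

Lemma near_identity_surj (e : A) : `|e| <= C ->
  forall x, exists2 y, y - c *: (y - y <| e) = x & `|y| <= 2 * `|x|.
Proof.
move=> eC; apply: (@small_perturbation_surj K B (fun y => c *: (y - y <| e))).
  move=> y z; rewrite linearBl -scalerBr; congr (_ *: _).
  by rewrite opprD addrACA -opprD.
move=> y; rewrite normrZ gtr0_norm// /c mulrAC ler_pdivrMr// -mulrA ler_wpM2l//.
  by rewrite invr_ge0 ler0n.
rewrite (le_trans (ler_normB _ _))// mulrDr mulr1 lerD2l (le_trans (actM _ _))//.
by rewrite mulrA [`|y| * M]mulrC ler_wpM2l// mulr_ge0.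
Qed.

(** Multiplying r^n + a on the right by (1 - c) + c e gives r^(n+1) + a', where
    a' - a = c (a e - a) + c r^n e is of order r^n as soon as a e is close to a.
    The old y solves the new equation up to the error c (b - b e), and a preimage
    of that error corrects y.  Its norm is at most 2^(n+1) |b - b e|, so that e
    must be chosen with |b - b e| of order (r / 2)^n. *)
Lemma factor_step n s : factor_invariant n s ->
  exists s', [/\ factor_invariant n.+1 s',
    `|s'.1 - s.1| <= (2 + C) * r ^+ n & `|s'.2 - s.2| <= (2 + C) * r ^+ n].
Proof.
case: s => al be [] /= Qbe Qsurj.
pose d := (r / 2) ^+ n.
have d0 : 0 < d by rewrite exprn_gt0// divr_gt0// ltr0n.
have [e [eC ale bee]] := approx al d0.
pose al' := al + c *: (al ** e - al + r ^+ n *: e).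
pose T y := y - c *: (y - y <| e).
have Q'E y :
    unitization_action (r ^+ n.+1) al' y = T (unitization_action (r ^+ n) al y).
  rewrite /T /unitization_action linearDr linearZr linearDr linearBr linearZr.
  rewrite linearDl linearZl /= module_actionA.
  set P := r ^+ n *: y; set q := y <| al; set X := y <| (al ** e).
  have -> : r ^+ n.+1 *: y = P - c *: P by rewrite exprS -scalerA scalerBl scale1r.
  rewrite addrACA -!(scalerN c) -scalerDr; congr (_ + _ *: _).
  by rewrite opprB opprD addrC [_ + r ^+ n *: _]addrC [- P - q]addrC !addrA.
have Q'surj x : exists2 y, unitization_action (r ^+ n.+1) al' y = x
    & `|y| <= 2 ^+ n.+1 * `|x|.
  have [z zx zle] := near_identity_surj eC x; have [y yz yle] := Qsurj z.
  exists y; first by rewrite Q'E yz.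
  by rewrite (le_trans yle)// exprSr -mulrA ler_wpM2l// exprn_ge0// ler0n.
have [y yE yle] := Q'surj (c *: (b - b <| e)).
exists (al', be + y); split=> /=.
- by split=> //=; rewrite unitization_actionD yE Q'E Qbe subrK.
- rewrite addrC addKr normrZ gtr0_norm// (le_trans (ler_piMl _ (ltW c1)))//.
  rewrite (le_trans (ler_normD _ _))// mulrDl; apply: lerD.
    rewrite (le_trans ale)// (@le_trans _ _ (r ^+ n))//.
      rewrite /d lerXn2r ?nnegrE ?divr_ge0 ?ltW// ltr_pdivrMr// ltr_pMr// ltr1n//.
    by rewrite ler_peMl// ler1n.
  by rewrite normrZ ger0_norm// mulrC ler_wpM2r.
- rewrite addrC addKr (le_trans yle)// normrZ gtr0_norm//.
  rewrite (@le_trans _ _ (2 ^+ n.+1 * d))//.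
    rewrite ler_wpM2l ?exprn_ge0// (le_trans (ler_piMl _ (ltW c1)))//.
    by rewrite distrC.
  rewrite /d expr_div_n exprS -mulrA [2 ^+ n * _]mulrC divfK ?expf_neq0 ?pnatr_eq0//.
  by rewrite ler_wpM2r// lerDl.
Qed.

(** The pairs (a_n, y_n) produced by [factor_step] converge geometrically, and
    b = r^n y_n + y_n a_n tends to y a. *)
Lemma cohen_factorization : exists (y : B) (a : A), b = y <| a.
Proof.
have /choice[f fP] : forall ns : nat * (A * B), exists s',
    factor_invariant ns.1 ns.2 -> [/\ factor_invariant ns.1.+1 s',
      `|s'.1 - ns.2.1| <= (2 + C) * r ^+ ns.1
    & `|s'.2 - ns.2.2| <= (2 + C) * r ^+ ns.1].
  move=> [n s] /=; have [/factor_step[s' ?]|ns] := pselect (factor_invariant n s).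
    by exists s'.
  by exists s.
pose s := nat_rect (fun=> (A * B)%type) (0, b) (fun n s => f (n, s)).
have sinv n : factor_invariant n (s n).
  elim: n => [|n IH]; last by have [] := fP (n, s n) IH.
  split=> [|x].
    by rewrite /unitization_action /= expr0 scale1r linear0r addr0.
  exists x; last by rewrite expr0 mul1r.
  by rewrite /unitization_action /= expr0 scale1r linear0r addr0.
have D0 : 0 <= 2 + C by rewrite addr_ge0.
have [a [Ea Ea0 sa]] : exists l,
    exists2 E, 0 <= E & forall n, `|l - (s n).1| <= E * r ^+ n.
  by apply: (geometric_cvg r01 D0) => n; have [] := fP (n, s n) (sinv n).
have [y [Ey Ey0 sy]] : exists l,
    exists2 E, 0 <= E & forall n, `|l - (s n).2| <= E * r ^+ n.
  by apply: (geometric_cvg r01 D0) => n; have [] := fP (n, s n) (sinv n).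
exists y, a; apply/eqP; rewrite -subr_eq0; apply/eqP.
pose E := (`|y| + Ey) + (M * Ey * (`|a| + Ea) + M * `|y| * Ea).
apply: (@geometric_eq0 K B r E) => // [|n].
  by rewrite !addr_ge0// !mulr_ge0// addr_ge0.
have [Qn _] := sinv n; set al := (s n).1 in Qn; set be := (s n).2 in Qn.
have rn1 : r ^+ n <= 1 by rewrite exprn_ile1// ltW//; case/andP: r01.
have bound (V : normedModType K) (l z : V) F : 0 <= F -> `|l - z| <= F * r ^+ n ->
    `|z| <= `|l| + F.
  move=> F0 lz; rewrite -[z](subKr l) (le_trans (ler_normB _ _))// lerD2l.
  by rewrite (le_trans lz)// ler_piMr.
have be_le : `|be| <= `|y| + Ey := bound _ _ _ _ Ey0 (sy n).
have al_le : `|al| <= `|a| + Ea := bound _ _ _ _ Ea0 (sa n).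
have -> : b - y <| a = r ^+ n *: be + (- ((y - be) <| al) - y <| (a - al)).
  rewrite -[in LHS]Qn /unitization_action linearBl linearBr -addrA; congr (_ + _).
  by rewrite !opprB addrA subrK.
rewrite (le_trans (ler_normD _ _))// /E mulrDl; apply: lerD.
  by rewrite normrZ ger0_norm// mulrC ler_wpM2r.
rewrite (le_trans (ler_normB _ _))// normrN mulrDl; apply: lerD.
  rewrite (le_trans (actM _ _))// [leRHS]mulrAC -(mulrA M Ey).
  by apply: ler_pM => //; [rewrite mulr_ge0|exact: ler_wpM2l (sy n)].
rewrite (le_trans (actM _ _))// -[leRHS]mulrA.
by apply: ler_wpM2l (sa n); rewrite mulr_ge0.
Qed.

End Step.
End Cohen.

(** * From weak-star to norm approximation *)

Section Duality.
Variable K : scalarField.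

Fact evaluation_subproof (X : normedModType K) (x : X) :
  (fun f : dual X => f x : K^o) \in @functionals K (dual X).
Proof.
apply/asboolP; split=> [a f g //|].
by exists `|x| => f; rewrite mulrC ler_norm_dual.
Qed.

Definition evaluation (X : normedModType K) (x : X) : dual (dual X) :=
  Dual (evaluation_subproof x).

(** Hahn-Banach for the seminorm p z = inf_u (|u| + W (|z.1 - m1 y1 u| +
    |z.2 - m2 y2 u|)) yields F dominated by p with p (z1, z2) <= |F (z1, z2)|.
    The functional h = F (m1 y1 _, m2 y2 _) has norm at most 1, since
    p (m1 y1 u, m2 y2 u) <= |u|, and e'' h = F (z1, z2); hence
    p (z1, z2) <= |e''|, and some u comes within 1 of this infimum. *)
Lemma weak_star_to_norm_approx (X Y1 Y2 Z1 Z2 : normedModType K)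
    (m1 : bounded_bilinear Y1 X Z1) (m2 : bounded_bilinear Y2 X Z2)
    (y1 : Y1) (y2 : Y2) (z1 : Z1) (z2 : Z2) (e'' : dual (dual X)) :
  (forall f, e'' (adjoint m1 f y1) = f z1) ->
  (forall f, e'' (adjoint m2 f y2) = f z2) ->
  forall d : K, 0 < d ->
  exists u : X, [/\ `|u| <= `|e''| + 1,
    `|m1 y1 u - z1| <= d & `|m2 y2 u - z2| <= d].
Proof.
move=> e1 e2 d d0; pose E := `|e''| + 1.
have E0 : 0 < E by rewrite ltr_wpDl.
(* The penalty W is large enough for W t <= E to give t <= d. *)
pose W := E / d; have W0 : 0 < W by rewrite divr_gt0.
pose g (u : X) (z : Z1 * Z2) : K :=
  `|u| + W * (`|z.1 - m1 y1 u| + `|z.2 - m2 y2 u|).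
pose p := pointwise_inf g.
have g0 u z : 0 <= g u z by rewrite addr_ge0// mulr_ge0 ?addr_ge0// ltW.
have gr u z : g u z \is Num.real by rewrite ger0_real.
have real0 (z : Z1 * Z2) : 0 \is @Num.real K by rewrite rpred0.
have le u z : p z <= g u z :=
  pointwise_inf_le (g := g) 0 (gr^~ z) (real0 z) (g0^~ z) u.
have gZ a u z : g (a *: u) (a *: z) = `|a| * g u z.
  by rewrite /g /= !linearZr /= -!scalerBr !normrZ -mulrDr mulrCA -mulrDr.
have ps : sublinear p.
  apply: (sublinear_pointwise_inf 0 gr real0 g0) => [u v z w|t u z t0].
    exists (u + v); rewrite /g /= !linearDr addrACA lerD ?ler_normD//.
    rewrite -mulrDr ler_wpM2l ?(ltW W0)// addrACA !opprD.
    by rewrite lerD// addrACA ler_normD.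
  by exists (t *: u); rewrite gZ gtr0_norm.
have [pr pD _] := ps.
have pZ a z : p (a *: z) <= `|a| * p z.
  have [->|a0] := eqVneq a 0; first by rewrite scale0r normr0 mul0r sublinear0.
  have na0 : 0 < `|a| by rewrite normr_gt0.
  rewrite -ler_pdivrMl//; apply: (le_pointwise_inf 0 (gr^~ z) (real0 z) (g0^~ z)) => u.
  by rewrite ler_pdivrMl// -gZ.
have [F [Fl Fp Fz]] := @hahn_banach K (Z1 * Z2)%type p (z1, z2) pr pD pZ.
have FD z w : F (z + w) = F z + F w by have := Fl 1 z w; rewrite !scale1r.
have f1P : (fun x => F (x, 0)) \in @functionals K Z1.
  apply/asboolP; split=> [a x y|].
    rewrite -Fl; congr F; apply/pair_equal_spec; split=> //=.
    by rewrite scaler0 addr0.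
  exists W => x; rewrite (le_trans (Fp _))// (le_trans (le 0 _))// /g /=.
  by rewrite !linear0r !subr0 !normr0 addr0 add0r.
have f2P : (fun x => F (0, x)) \in @functionals K Z2.
  apply/asboolP; split=> [a x y|].
    rewrite -Fl; congr F; apply/pair_equal_spec; split=> //=.
    by rewrite scaler0 addr0.
  exists W => x; rewrite (le_trans (Fp _))// (le_trans (le 0 _))// /g /=.
  by rewrite !linear0r !subr0 !normr0 !add0r.
have F12 x y : F (x, 0) + F (0, y) = F (x, y).
  by rewrite -FD; congr F; apply/pair_equal_spec; rewrite /= addr0 add0r.
pose h : dual X := adjoint m1 (Dual f1P) y1 + adjoint m2 (Dual f2P) y2.
have h1 : `|h| <= 1.
  apply: dual_norm_le => // u; rewrite mul1r.
  have -> : h u = F (m1 y1 u, m2 y2 u) by rewrite -F12.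
  rewrite (le_trans (Fp _))// (le_trans (le u _))// /g /=.
  by rewrite !subrr !normr0 addr0 mulr0 addr0.
have eh : e'' h = F (z1, z2).
  have e1F : e'' (adjoint m1 (Dual f1P) y1) = F (z1, 0) by exact: e1.
  have e2F : e'' (adjoint m2 (Dual f2P) y2) = F (0, z2) by exact: e2.
  by rewrite -F12 -e1F -e2F; exact: raddfD.
have pE : p (z1, z2) <= `|e''|.
  by rewrite (le_trans Fz)// -eh (le_trans (ler_norm_dual _ _))// ler_piMr.
have [u gu] : exists u, g u (z1, z2) < E.
  apply: contrapT => /forallNP gE.
  have : E <= p (z1, z2).
    apply: (le_pointwise_inf 0 (gr^~ (z1, z2)) (real0 0) (g0^~ (z1, z2))) => u.
    by rewrite real_leNgt ?gr ?(gtr0_real E0)//; apply/negP/gE.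
  by move=> /le_trans/(_ pE); rewrite /E gerDl ler10.
exists u; split.
- by rewrite (le_trans _ (ltW gu))// lerDl mulr_ge0 ?addr_ge0// ltW.
- rewrite distrC -(ler_pM2l W0) divfK ?gt_eqF// (le_trans _ (ltW gu))//.
  by rewrite ler_wpDl// ler_pM2l// lerDl.
- rewrite distrC -(ler_pM2l W0) divfK ?gt_eqF// (le_trans _ (ltW gu))//.
  by rewrite ler_wpDl// ler_pM2l// lerDr.
Qed.

End Duality.

(** * The theorem *)

Theorem mainTheorem4 (K : scalarField)
  (A : banachAlgebra K) (B : rightBanachModule A) (e'' : dual (dual A)) :
  (forall a'' : dual (dual A), arens_mul A a'' e'' = a'') ->
  ([set: B] = [set module_action B b a | b in [set: B] & a in [set: A]] <->
   forall b'' : dual (dual B), triple_adjoint (module_action B) b'' e'' = b'').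
Proof.
move=> e''r.
have eA (f : dual A) (a : A) : e'' (adjoint (banach_mul A) f a) = f a.
  exact: (congr1 (fun x'' : dual (dual A) => x'' f) (e''r (evaluation a))).
split=> [BA b''|e''B].
  have eB (f : dual B) (b : B) : e'' (adjoint (module_action B) f b) = f b.
    have : [set: B] b by [].
    rewrite BA => -[b1 _ [a _ <-]].
    have -> : adjoint (module_action B) f (module_action B b1 a) =
        adjoint (banach_mul A) (adjoint (module_action B) f b1) a.
      by apply/val_inj/funext => a' /=; rewrite module_actionA.
    by rewrite eA.
  apply/val_inj/funext => f /=; congr (b'' _).
  by apply/val_inj/funext => b /=; exact: eB.
have eB (f : dual B) (b : B) : e'' (adjoint (module_action B) f b) = f b.
  exact: (congr1 (fun x'' : dual (dual B) => x'' f) (e''B (evaluation b))).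
apply/seteqP; split=> // b _.
have [M M0 actM] := bilinear_boundedW (module_action B).
have E0 : 0 <= `|e''| + 1 by rewrite addr_ge0.
have [|y [a ->]] := @cohen_factorization K A B M (`|e''| + 1) b M0 actM E0.
  by move=> a d; exact: weak_star_to_norm_approx (eA^~ a) (eB^~ b) d.
by exists y => //; exists a.
Qed.
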